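(* Let $E$ be a Dedekind complete vector lattice and let $K$ be an extremally disconnected compact Hausdorff space such that the universal completion $E^u$ of $E$ is represented as $E^u\cong\{f\in C(K,\overline{\mathbb{R}}) : f^{-1}(\mathbb{R})\text{ is open and dense}\}$. Then the sup-inf-completion $E^{si}$ of $E$ is isomorphic to $C(K,\overline{\mathbb{R}})$ as lattice stars.
   Context: $\overline{\mathbb{R}}=[-\infty,\infty]$; $C(K,\overline{\mathbb{R}})$ is the set of continuous functions $K\to\overline{\mathbb{R}}$ with pointwise order and pointwise scalar multiplication (with $0\cdot(\pm\infty)=0$). The space $K$ exists by the Maeda–Ogasawara representation theorem. A star is a set $S$ with a scalar multiplication $\mathbb{R}\times S\to S$ such that $\lambda(\mu x)=(\lambda\mu)x$, $1x=x$, and there is $0\in S$ with $0x=0$ for all $x$. A lattice star is a star with a lattice order such that $x\le y$ implies $\lambda x\le\lambda y$ for real $\lambda\ge0$ and $-x\ge -y$. A lattice star isomorphism is a bijection $\phi$ with $\phi(\lambda x)=\lambda\phi(x)$ ($\lambda\in\mathbb{R}$) and $\phi(x\vee y)=\phi(x)\vee\phi(y)$. Sup-completion. A cone is a commutative monoid with a scalar multiplication by $\mathbb{R}^+=[0,\infty)$ satisfying $\lambda(x+y)=\lambda x+\lambda y$, $(\lambda+\mu)x=\lambda x+\mu x$, $\lambda(\mu x)=(\lambda\mu)x$, $1x=x$, $0x=0$; a lattice cone is a cone with a lattice order compatible with addition and with multiplication by $\mathbb{R}^+$. The sup-completion $E^s$ is the essentially unique lattice cone $C$ such that: nonempty subsets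 of $C$ bounded above (below) have suprema (infima); $E$ is the set of additively invertible elements of $C$, with coinciding structures; $y=\sup\{x\in E: x\le y\}$ for $y\in C$; $z+(x\wedge y)=(z+x)\wedge(z+y)$ for $x\in E$, $y,z\in C$; $x\in E$, $y\in C$, $y\le x$ imply $y\in E$; $C$ has a largest element; and $\sup A=\sup B$ for nonempty $A,B\subseteq C$ implies $\sup(A\wedge x)=\sup(B\wedge x)$ for all $x\in E$. (It is known that $E^s\cong\{f\in C(K,\overline{\mathbb{R}}) : \text{there is } x\in E \text{ with } x\le f\}$ as lattice cones.) Sup-inf-completion. $E^{si}$ is (up to lattice star isomorphism) the lattice star $\{(x,y)\in E^s_+\times E^s_+ : x\wedge y=0\}$, where $E^s_+=\{x\in E^s:x\ge0\}$, with $\lambda(x,y)=(\lambda x,\lambda y)$ and $-\lambda(x,y)=(\lambda y,\lambda x)$ for $\lambda\in\mathbb{R}^+$, ordered by $(x,y)\le(z,w)$ iff $x\le z$ and $w\le y$. *)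

(* Defs.v *)
From HB Require Import structures.
From mathcomp Require Import all_boot all_order all_algebra.
From mathcomp Require Import all_classical all_reals all_analysis.

Set Implicit Arguments.
Unset Strict Implicit.
Unset Printing Implicit Defensive.

Import Order.TTheory GRing.Theory Num.Theory.
Import numFieldNormedType.Exports.

Local Open Scope classical_set_scope.
Local Open Scope ring_scope.

(* [Num.POrderedZmodule] only joins the two signatures; the compatibility axioms
   are those of this mixin.  The library has no join of [Order.Lattice] and
   [GRing.Zmodule], so the lattice operations are given by their universal
   properties and [Order.Lattice] is recovered as an instance. *)
HB.mixin Record isVectorLattice (R : numDomainType) (E : Type)
    of Num.POrderedZmodule E & GRing.Lmodule R E := {
  vlat_meet : E -> E -> E ;
  vlat_join : E -> E -> E ;
  vlat_lexI : forall x y z : E, (x <= vlat_meet y z) = (x <= y) && (x <= z) ;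
  vlat_leUx : forall x y z : E, (vlat_join x y <= z) = (x <= z) && (y <= z) ;
  vlat_leD2r : forall z x y : E, x <= y -> x + z <= y + z ;
  vlat_leZ : forall (a : R) (x y : E), 0 <= a -> x <= y -> a *: x <= a *: y
}.

#[short(type="vectorLatticeType")]
HB.structure Definition VectorLattice (R : numDomainType) :=
  {E of Num.POrderedZmodule E & GRing.Lmodule R E & isVectorLattice R E}.

HB.instance Definition _ (R : numDomainType) (E : vectorLatticeType R) :=
  Order.POrder_MeetJoin_isLattice.Build ring_display E (@vlat_lexI R E) (@vlat_leUx R E).

Definition dedekind_complete (d : Order.disp_t) (T : porderType d) : Prop :=
  forall A : set T, has_sup A -> supremums A !=set0.

(* Nonemptiness excludes [A = set0], whose only possible supremum would be a
   least element. *)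
Definition laterally_complete (R : numDomainType)
    (E : vectorLatticeType R) : Prop :=
  forall A : set E, A !=set0 ->
    (forall x, A x -> 0 <= x) ->
    (forall x y, A x -> A y -> x != y -> Order.meet x y = 0) ->
    supremums A !=set0.

(** [Eu] is a universal completion of [E]: a universally complete vector
    lattice in which [E] is embedded, via [j], as an order dense vector
    sublattice. *)
Record is_universal_completion (R : realType)
    (E Eu : vectorLatticeType R) (j : {linear E -> Eu}) : Prop := {
  ucompl_dedekind : dedekind_complete Eu ;
  ucompl_lateral : laterally_complete Eu ;
  ucompl_inj : injective j ;
  ucompl_join : {morph j : x y / Order.join x y} ;
  ucompl_meet : {morph j : x y / Order.meet x y} ;
  ucompl_dense : forall y : Eu, 0 < y -> exists x : E, 0 < j x <= y
}.

HB.mixin Record isStar (R : numDomainType) (S : Type) of Choice S := {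
  starZ : R -> S -> S ;
  star0 : S ;
  starZA : forall (a b : R) (x : S), starZ a (starZ b x) = starZ (a * b) x ;
  star1Z : forall x : S, starZ 1 x = x ;
  star0Z : forall x : S, starZ 0 x = star0
}.

#[short(type="starType")]
HB.structure Definition Star (R : numDomainType) := {S of Choice S & isStar R S}.

HB.mixin Record Star_isLatticeStar (R : numDomainType) (d : Order.disp_t)
    (S : Type) of Order.Lattice d S & Star R S := {
  lstar_leZ : forall (a : R) (x y : S),
    0 <= a -> (x <= y)%O -> (starZ a x <= starZ a y)%O ;
  lstar_leN : forall x y : S,
    (x <= y)%O -> (starZ (- 1 : R) y <= starZ (- 1 : R) x)%O
}.

#[short(type="latticeStarType")]
HB.structure Definition LatticeStar (R : numDomainType) (d : Order.disp_t) :=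
  {S of Order.Lattice d S & Star R S & Star_isLatticeStar R d S}.

Definition is_lattice_star_iso (R : numDomainType) (dS dT : Order.disp_t)
    (S : latticeStarType R dS) (T : latticeStarType R dT) (phi : S -> T) : Prop :=
  [/\ bijective phi,
      forall (a : R) (x : S), phi (starZ a x) = starZ a (phi x) &
      {morph phi : x y / Order.join x y}].

Notation contExt K R := (continuousType K (\bar R)).

Section ContExt.
Context {R : realType} {K : topologicalType}.
Implicit Types f g h : contExt K R.

Definition ctse_le f g : bool := `[< forall k, (f k <= g k)%E >].

Fact ctse_le_refl : reflexive ctse_le.
Proof. by move=> f; apply/asboolP => k. Qed.

Fact ctse_le_anti : antisymmetric ctse_le.
Proof.
move=> f g /andP[/asboolP fg /asboolP gf]; apply/continuousEP => k.
by apply/eqP; rewrite eq_le fg gf.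
Qed.

Fact ctse_le_trans : transitive ctse_le.
Proof.
move=> g f h /asboolP fg /asboolP gh; apply/asboolP => k.
exact: (le_trans (fg k) (gh k)).
Qed.

HB.instance Definition _ := Order.Le_isPOrder.Build Order.default_display
  (contExt K R) ctse_le_refl ctse_le_anti ctse_le_trans.

Fact ctse_max_cts f g : continuous (fun k => maxe (f k) (g k)).
Proof. by apply: (@max_fun_continuous _ K (\bar R) f g); exact: cts_fun. Qed.

Fact ctse_min_cts f g : continuous (fun k => mine (f k) (g k)).
Proof. by apply: (@min_fun_continuous _ K (\bar R) f g); exact: cts_fun. Qed.

Definition ctse_join f g : contExt K R := mkcts (@ctse_max_cts f g).
Definition ctse_meet f g : contExt K R := mkcts (@ctse_min_cts f g).

Fact ctse_meetP f g h : (f <= ctse_meet g h)%O = (f <= g)%O && (f <= h)%O.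
Proof.
apply/asboolP/andP => [H|[/asboolP fg /asboolP fh] k].
  by split; apply/asboolP => k; move: (H k); rewrite le_min => /andP[].
by rewrite le_min fg fh.
Qed.

Fact ctse_joinP g h f : (ctse_join g h <= f)%O = (g <= f)%O && (h <= f)%O.
Proof.
apply/asboolP/andP => [H|[/asboolP fg /asboolP fh] k].
  by split; apply/asboolP => k; move: (H k); rewrite ge_max => /andP[].
by rewrite ge_max fg fh.
Qed.

HB.instance Definition _ := Order.POrder_MeetJoin_isLattice.Build
  Order.default_display (contExt K R) ctse_meetP ctse_joinP.

Fact ctse_scale_cts (a : R) f : continuous (fun k => (a%:E * f k)%E).
Proof. by move=> k; apply: cvgeZl => //; exact: cts_fun. Qed.

(* [mule] satisfies [0 * +oo = 0 * -oo = 0]. *)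
Definition ctse_scale (a : R) f : contExt K R := mkcts (@ctse_scale_cts a f).
Definition ctse_zero : contExt K R := cst 0%E.

Fact ctse_scaleA a b f :
  ctse_scale a (ctse_scale b f) = ctse_scale (a * b) f.
Proof. by apply/continuousEP => k; rewrite /= /mkcts EFinM muleA. Qed.

Fact ctse_scale1 f : ctse_scale 1 f = f.
Proof. by apply/continuousEP => k; rewrite /= /mkcts mul1e. Qed.

Fact ctse_scale0 f : ctse_scale 0 f = ctse_zero.
Proof. by apply/continuousEP => k; rewrite /= /mkcts mul0e. Qed.

HB.instance Definition _ :=
  isStar.Build R (contExt K R) ctse_scaleA ctse_scale1 ctse_scale0.

Fact ctse_leZ (a : R) f g :
  0 <= a -> (f <= g)%O -> (starZ a f <= starZ a g)%O.
Proof.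
by move=> a0 /asboolP fg; apply/asboolP => k; apply: lee_wpmul2l; rewrite ?lee_fin.
Qed.

Fact ctse_leN f g :
  (f <= g)%O -> (starZ (- 1 : R) g <= starZ (- 1 : R) f)%O.
Proof.
move=> /asboolP fg; apply/asboolP => k; rewrite /= /mkcts.
by rewrite EFinN !mulN1e leeN2.
Qed.

HB.instance Definition _ := Star_isLatticeStar.Build R Order.default_display
  (contExt K R) ctse_leZ ctse_leN.

End ContExt.

Definition extremally_disconnected (T : topologicalType) : Prop :=
  forall U : set T, open U -> open (closure U).

Definition finite_locus (R : realType) (K : topologicalType) (f : contExt K R)
  : set K := [set k | f k \is a fin_num].

Definition Cinfty (R : realType) (K : topologicalType) : set (contExt K R) :=
  [set f | open (finite_locus f) /\ dense (finite_locus f)].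

(** [Phi] is a vector lattice isomorphism of [V] onto [Cinfty R K].  The sum of
    [f] and [g] in [Cinfty R K] is its unique element that agrees with the
    pointwise sum on the dense set where [f] and [g] are both finite; the order
    and the multiplication by reals are pointwise. *)
Record is_Cinfty_iso (R : realType) (K : topologicalType) 
    (V : vectorLatticeType R) (Phi : V -> contExt K R) : Prop := {
  cinf_bij : set_bij [set: V] (@Cinfty R K) Phi ;
  cinf_add : forall (x y : V) (k : K),
    Phi x k \is a fin_num -> Phi y k \is a fin_num ->
    Phi (x + y) k = (Phi x k + Phi y k)%E ;
  cinf_scale : forall (a : R) (x : V), Phi (a *: x) = starZ a (Phi x) ;
  cinf_join : {morph Phi : x y / Order.join x y} ;
  cinf_meet : {morph Phi : x y / Order.meet x y}
}.

Record nnscalar (R : numDomainType) := NNScalar {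
  nnval :> R ;
  nnval_ge0 : 0 <= nnval
}.

Section NNScalar.
Context {R : numDomainType}.

HB.instance Definition _ := [isSub for @nnval R].
HB.instance Definition _ := [Choice of nnscalar R by <:].

Implicit Types a b c : nnscalar R.

Definition nn0 : nnscalar R := NNScalar (lexx 0).
Definition nn1 : nnscalar R := NNScalar ler01.
Definition nnD a b := NNScalar (addr_ge0 (nnval_ge0 a) (nnval_ge0 b)).
Definition nnM a b := NNScalar (mulr_ge0 (nnval_ge0 a) (nnval_ge0 b)).

Fact nnDA : associative nnD.
Proof. by move=> a b c; apply/val_inj/addrA. Qed.
Fact nnDC : commutative nnD.
Proof. by move=> a b; apply/val_inj/addrC. Qed.
Fact nn0D : left_id nn0 nnD.
Proof. by move=> a; apply/val_inj/add0r. Qed.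
Fact nnMA : associative nnM.
Proof. by move=> a b c; apply/val_inj/mulrA. Qed.
Fact nn1M : left_id nn1 nnM.
Proof. by move=> a; apply/val_inj/mul1r. Qed.
Fact nnM1 : right_id nn1 nnM.
Proof. by move=> a; apply/val_inj/mulr1. Qed.
Fact nnMDl : left_distributive nnM nnD.
Proof. by move=> a b c; apply/val_inj/mulrDl. Qed.
Fact nnMDr : right_distributive nnM nnD.
Proof. by move=> a b c; apply/val_inj/mulrDr. Qed.
Fact nn0M : left_zero nn0 nnM.
Proof. by move=> a; apply/val_inj/mul0r. Qed.
Fact nnM0 : right_zero nn0 nnM.
Proof. by move=> a; apply/val_inj/mulr0. Qed.

HB.instance Definition _ := GRing.isPzSemiRing.Build (nnscalar R)
  nnDA nnDC nn0D nnMA nn1M nnM1 nnMDl nnMDr nn0M nnM0.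

End NNScalar.

HB.mixin Record isLatticeCone (R : numDomainType) (C : Type)
    of Order.Lattice ring_display C := {
  coneD : C -> C -> C ;
  cone0 : C ;
  coneZ : nnscalar R -> C -> C ;
  coneDA : associative coneD ;
  coneDC : commutative coneD ;
  cone0D : left_id cone0 coneD ;
  coneZDr : forall a (x y : C), coneZ a (coneD x y) = coneD (coneZ a x) (coneZ a y) ;
  coneZDl : forall a b (x : C), coneZ (a + b) x = coneD (coneZ a x) (coneZ b x) ;
  coneZA : forall a b (x : C), coneZ a (coneZ b x) = coneZ (a * b) x ;
  cone1Z : forall x : C, coneZ 1 x = x ;
  cone0Z : forall x : C, coneZ 0 x = cone0 ;
  cone_leD2r : forall z x y : C, x <= y -> coneD x z <= coneD y z ;
  cone_leZ : forall a (x y : C), x <= y -> coneZ a x <= coneZ a y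
}.

#[short(type="latticeConeType")]
HB.structure Definition LatticeCone (R : numDomainType) :=
  {C of Order.Lattice ring_display C & isLatticeCone R C}.

HB.instance Definition _ (R : numDomainType) (C : latticeConeType R) :=
  GRing.isNmodule.Build C (@coneDA R C) (@coneDC R C) (@cone0D R C).

Fact coneZDl_subproof (R : numDomainType) (C : latticeConeType R) (x : C) :
  {morph (@coneZ R C)^~ x : a b / a + b}.
Proof. by move=> a b; exact: coneZDl. Qed.

HB.instance Definition _ (R : numDomainType) (C : latticeConeType R) :=
  GRing.Nmodule_isLSemiModule.Build (nnscalar R) C
    (@coneZA R C) (@cone0Z R C) (@cone1Z R C) (@coneZDr R C)
    (@coneZDl_subproof R C).

Fact lcone_leZ (R : numDomainType) (C : latticeConeType R) (a : nnscalar R) (x y : C) :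
  x <= y -> a *: x <= a *: y.
Proof. exact: cone_leZ. Qed.

(* [E] is identified with a subset of its sup-completion by means of [scin]. *)
Record supCompletion (R : realType) (E : vectorLatticeType R) := SupCompletion {
  scompl_cone :> latticeConeType R ;
  scompl_sup : forall A : set scompl_cone, has_sup A -> supremums A !=set0 ;
  scompl_inf : forall A : set scompl_cone, has_inf A -> infimums A !=set0 ;
  scin : E -> scompl_cone ;
  scin0 : scin 0 = 0 ;
  scinD : forall x y : E, scin (x + y) = scin x + scin y ;
  scinZ : forall (a : nnscalar R) (x : E), scin (nnval a *: x) = a *: scin x ;
  scin_le : forall x y : E, (scin x <= scin y) = (x <= y) ;
  scin_meet : forall x y : E, scin (Order.meet x y) = Order.meet (scin x) (scin y) ;
  scin_join : forall x y : E, scin (Order.join x y) = Order.join (scin x) (scin y) ;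
  scin_invertible : forall c : scompl_cone, range scin c <-> exists c', c + c' = 0 ;
  scompl_dense : forall y : scompl_cone,
    supremums [set scin x | x in [set x | scin x <= y]] y ;
  scompl_addI : forall (x : E) (y z : scompl_cone),
    z + Order.meet (scin x) y = Order.meet (z + scin x) (z + y) ;
  scompl_solid : forall (x : E) (y : scompl_cone), y <= scin x -> range scin y ;
  scompl_top : exists t : scompl_cone, forall y, y <= t ;
  scompl_supI : forall (A B : set scompl_cone) (s : scompl_cone),
    A !=set0 -> B !=set0 -> supremums A s -> supremums B s ->
    forall (x : E) (t u : scompl_cone),
      supremums [set Order.meet a (scin x) | a in A] t ->
      supremums [set Order.meet b (scin x) | b in B] u -> t = u
}.

Section SupCompletionTheory.
Context {R : realType} {E : vectorLatticeType R} {C : supCompletion E}.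
Implicit Types (x y z t u v w : C) (e : E) (a b : nnscalar R).

Let supremums2 x y : supremums [set x; y] (Order.join x y).
Proof.
split => [z [->|->]|z Uz]; [exact: leUl|exact: leUr|].
by rewrite leUx !Uz //; [right|left].
Qed.

Lemma scompl_meet_scinUl e x y :
  Order.meet (Order.join x y) (scin C e) =
  Order.join (Order.meet x (scin C e)) (Order.meet y (scin C e)).
Proof.
have := @scompl_supI _ _ C [set Order.join x y] [set x; y] (Order.join x y).
move=> /(_ (ex_intro _ _ erefl) (ex_intro _ x (or_introl erefl))).
rewrite supremums1 => /(_ erefl (supremums2 x y) e).
rewrite image_set1 supremums1 => /(_ _ _ erefl); apply.
by rewrite image_setU !image_set1; exact: supremums2.
Qed.

Lemma scompl_meetUl t x y :
  Order.meet (Order.join x y) t =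
  Order.join (Order.meet x t) (Order.meet y t).
Proof.
apply/eqP; rewrite eq_le; apply/andP; split; last first.
  by rewrite leUx; apply/andP; split; apply: leI2; rewrite ?leUl ?leUr.
set u := Order.meet (Order.join x y) t.
have [_ lub_u] := @scompl_dense _ _ C u; apply: lub_u => _ [e /= eu <-].
have /andP[exy et] : (scin C e <= Order.join x y) && (scin C e <= t) by rewrite -lexI.
rewrite -[leLHS](meet_r exy) scompl_meet_scinUl.
by apply: leU2; exact: leI2.
Qed.

Lemma lcone_scale_ge0 a x : (0 : C) <= x -> (0 : C) <= a *: x.
Proof. by move=> x0; rewrite -(scaler0 _ a); exact: lcone_leZ. Qed.

Lemma scompl_meet0Z a x y : (0 : C) <= x -> (0 : C) <= y ->
  Order.meet x y = 0 -> Order.meet (a *: x) (a *: y) = 0.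
Proof.
move=> x0 y0 xy0; apply/eqP; rewrite eq_le; apply/andP; split; last first.
  by rewrite lexI !lcone_scale_ge0.
have [a0|an0] := eqVneq a 0; first by rewrite a0 !scale0r meetxx.
have va0 : nnval a != 0 by apply: contra an0 => /eqP va0; apply/eqP/val_inj.
have va1 : 0 <= (nnval a)^-1 by rewrite invr_ge0 nnval_ge0.
have ba : NNScalar va1 * a = 1 by apply: val_inj => /=; rewrite mulVf.
have ab : a * NNScalar va1 = 1 by apply: val_inj => /=; rewrite mulfV.
set m := Order.meet _ _.
rewrite -[m]scale1r -ab -scalerA -[leRHS](scaler0 _ a).
apply: lcone_leZ; rewrite -xy0 lexI.
apply/andP; split.
  by rewrite -[leRHS]scale1r -ba -scalerA; apply: lcone_leZ; exact: leIl.
by rewrite -[leRHS]scale1r -ba -scalerA; apply: lcone_leZ; exact: leIr.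
Qed.

End SupCompletionTheory.

Section SupInf.
Context {R : realType} {E : vectorLatticeType R}.
Variable C : supCompletion E.

Definition is_disjoint_pair (u : C * C) : bool :=
  [&& (0 : C) <= u.1, (0 : C) <= u.2 & Order.meet u.1 u.2 == 0].

Record supInfCompletion := SupInfCompletion {
  sival : C * C ;
  sivalP : is_disjoint_pair sival
}.

HB.instance Definition _ := [isSub for sival].
HB.instance Definition _ := [Choice of supInfCompletion by <:].

Implicit Types p q r : supInfCompletion.

Definition si_le p q : bool :=
  ((sival p).1 <= (sival q).1) && ((sival q).2 <= (sival p).2).

Fact si_le_refl : reflexive si_le.
Proof. by move=> p; rewrite /si_le !lexx. Qed.

Fact si_le_anti : antisymmetric si_le.
Proof.
move=> p q /andP[/andP[p1 p2] /andP[q1 q2]]; apply: val_inj => /=.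
rewrite [LHS]surjective_pairing [RHS]surjective_pairing.
by congr pair; apply/eqP; rewrite eq_le; apply/andP.
Qed.

Fact si_le_trans : transitive si_le.
Proof.
move=> q p r /andP[p1 p2] /andP[q1 q2].
by rewrite /si_le (le_trans p1 q1) (le_trans q2 p2).
Qed.

HB.instance Definition _ := Order.Le_isPOrder.Build Order.default_display
  supInfCompletion si_le_refl si_le_anti si_le_trans.

Let disjUI (x y z w : C) : (0 : C) <= y -> (0 : C) <= w ->
  Order.meet x y = 0 -> Order.meet z w = 0 ->
  Order.meet (Order.join x z) (Order.meet y w) = 0.
Proof.
move=> y0 w0 xy zw; rewrite scompl_meetUl meetA xy [Order.meet y w]meetC.
by rewrite meetA zw (meet_l w0) (meet_l y0) joinxx.
Qed.

Fact si_join_subproof p q : is_disjoint_pair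
  (Order.join (sival p).1 (sival q).1, Order.meet (sival p).2 (sival q).2).
Proof.
case: p q => -[x y] /and3P[/= x0 y0 /eqP xy] [[z w] /and3P[/= z0 w0 /eqP zw]].
apply/and3P; split => /=; [|by rewrite lexI y0|by rewrite disjUI].
exact: le_trans x0 (leUl _ _).
Qed.

Fact si_meet_subproof p q : is_disjoint_pair
  (Order.meet (sival p).1 (sival q).1, Order.join (sival p).2 (sival q).2).
Proof.
case: p q => -[x y] /and3P[/= x0 y0 /eqP xy] [[z w] /and3P[/= z0 w0 /eqP zw]].
apply/and3P; split => /=; [by rewrite lexI x0| |].
  exact: le_trans y0 (leUl _ _).
by rewrite meetC disjUI // meetC.
Qed.

Definition si_join p q := SupInfCompletion (si_join_subproof p q).
Definition si_meet p q := SupInfCompletion (si_meet_subproof p q).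

Fact si_leE p q : (p <= q)%O =
  ((sival p).1 <= (sival q).1) && ((sival q).2 <= (sival p).2).
Proof. by []. Qed.

Fact si_meetP p q r : (p <= si_meet q r)%O = (p <= q)%O && (p <= r)%O.
Proof. by rewrite !si_leE lexI leUx andbACA. Qed.

Fact si_joinP q r p : (si_join q r <= p)%O = (q <= p)%O && (r <= p)%O.
Proof. by rewrite !si_leE lexI leUx andbACA. Qed.

HB.instance Definition _ := Order.POrder_MeetJoin_isLattice.Build
  Order.default_display supInfCompletion si_meetP si_joinP.

Fact si_opp_subproof p : is_disjoint_pair ((sival p).2, (sival p).1).
Proof.
by case: p => -[x y] /and3P[/= x0 y0 xy]; apply/and3P; rewrite meetC.
Qed.

Definition si_opp p := SupInfCompletion (si_opp_subproof p).

Fact si_nnscale_subproof (a : nnscalar R) p :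
  is_disjoint_pair (a *: (sival p).1, a *: (sival p).2).
Proof.
case: p => -[x y] /and3P[/= x0 y0 /eqP xy]; apply/and3P; split => /=.
- exact: lcone_scale_ge0.
- exact: lcone_scale_ge0.
- by rewrite scompl_meet0Z.
Qed.

Definition si_nnscale (a : nnscalar R) p :=
  SupInfCompletion (si_nnscale_subproof a p).

Definition nnabs (a : R) : nnscalar R := NNScalar (normr_ge0 a).

Definition si_scale (a : R) p :=
  if 0 <= a then si_nnscale (nnabs a) p else si_opp (si_nnscale (nnabs a) p).

Fact si_zero_subproof : is_disjoint_pair (0, 0).
Proof. by apply/and3P; rewrite /= lexx meetxx. Qed.

Definition si_zero := SupInfCompletion si_zero_subproof.

Let nnabs0 : nnabs 0 = 0. Proof. by apply: val_inj; rewrite /= normr0. Qed.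
Let nnabs1 : nnabs 1 = 1. Proof. by apply: val_inj; rewrite /= normr1. Qed.
Let nnabsM a b : nnabs (a * b) = nnabs a * nnabs b.
Proof. by apply: val_inj; rewrite /= normrM. Qed.

Fact si_scaleE (a : nnscalar R) p :
  sival (si_scale (nnval a) p) = (a *: (sival p).1, a *: (sival p).2).
Proof.
rewrite /si_scale nnval_ge0 /=.
have -> // : nnabs (nnval a) = a.
by apply: val_inj; rewrite /= ger0_norm // nnval_ge0.
Qed.

Fact si_scaleNE (a : nnscalar R) p :
  sival (si_scale (- nnval a) p) = (a *: (sival p).2, a *: (sival p).1).
Proof.
have abs_a : nnabs (- nnval a) = a.
  by apply: val_inj; rewrite /= normrN ger0_norm // nnval_ge0.
rewrite /si_scale; case: ifPn => [a_le0|_]; rewrite /= abs_a //.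
have -> : a = 0; last by rewrite !scale0r.
by apply/val_inj/eqP; rewrite /= eq_le nnval_ge0 andbT -oppr_ge0.
Qed.

Fact si_scale1 p : si_scale 1 p = p.
Proof.
by apply: val_inj; rewrite /si_scale ler01 /= nnabs1 !scale1r -surjective_pairing.
Qed.

Fact si_scale0 p : si_scale 0 p = si_zero.
Proof. by apply: val_inj; rewrite /si_scale lexx /= nnabs0 !scale0r. Qed.

Let si_scale_zero a : si_scale a si_zero = si_zero.
Proof. by apply: val_inj; rewrite /si_scale; case: ifP => _; rewrite /= !scaler0. Qed.

Fact si_scaleA a b p : si_scale a (si_scale b p) = si_scale (a * b) p.
Proof.
have [->|a0] := eqVneq a 0; first by rewrite mul0r !si_scale0.
have [->|b0] := eqVneq b 0; first by rewrite mulr0 !si_scale0 si_scale_zero.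
apply: val_inj; rewrite /si_scale.
have [ap|an|a0'] := ltrgtP 0 a; last by rewrite a0' eqxx in a0.
- by rewrite pmulr_rge0 //; case: ifP => _; rewrite /= !scalerA -!nnabsM.
- rewrite nmulr_rge0 //.
  have [bp|bn|b0'] := ltrgtP 0 b; last by rewrite b0' eqxx in b0.
  + by rewrite /= !scalerA -!nnabsM.
  + by rewrite /= !scalerA -!nnabsM.
Qed.

HB.instance Definition _ :=
  isStar.Build R supInfCompletion si_scaleA si_scale1 si_scale0.

Fact si_leZ (a : R) p q : 0 <= a -> (p <= q)%O -> (starZ a p <= starZ a q)%O.
Proof.
move=> a0; rewrite !si_leE => /andP[p1 p2].
by rewrite /starZ /= /si_scale a0 /= !lcone_leZ.
Qed.

Fact si_leN p q : (p <= q)%O -> (starZ (- 1 : R) q <= starZ (- 1 : R) p)%O.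
Proof.
rewrite !si_leE => /andP[p1 p2].
by rewrite /starZ /= /si_scale oppr_ge0 ler10 /= !lcone_leZ.
Qed.

HB.instance Definition _ := Star_isLatticeStar.Build R Order.default_display
  supInfCompletion si_leZ si_leN.

End SupInf.

(* Main.v *)
(** Both the positive cone of [E^s] and [C(K, [0, +oo])] are order completions
    of [E_+]: every element is the supremum of the elements of [E_+] below it,
    and for [e] in [E_+] the inequality [e <= sup B], with [B] a subset of
    [E_+], means that [e] is the supremum in [E] of the elements [b /\ e].  On
    the side of [E^s] this comes from the last axiom of the sup-completion
    together with solidity; on the side of [C(K, \bar R)] it comes from the
    order density of [E] in [E^u] and from the infinite distributive law,
    proved by gluing functions along clopen sets.  Sending [y] to the supremum
    of the elements of [E_+] below [y] is therefore an isomorphism [T] of the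
    two cones, and [(x, y) |-> T x - T y] is the isomorphism of lattice stars:
    disjointness of [x] and [y] makes [T x] and [T y] the positive and negative
    parts of the difference, which never has the form [oo - oo]. *)

Require Import Defs.
From HB Require Import structures.
From mathcomp Require Import all_boot all_order all_algebra.
From mathcomp Require Import all_classical all_reals all_analysis.

Set Implicit Arguments.
Unset Strict Implicit.
Unset Printing Implicit Defensive.

Import Order.TTheory GRing.Theory Num.Theory.
Import numFieldNormedType.Exports.
Local Open Scope classical_set_scope.
Local Open Scope ring_scope.

(** * Extended reals and clopen neighbourhoods *)

Lemma continuous_contract (R : realType) : continuous (@contract R).
Proof.
move=> x; apply/cvgrPdist_lt => e e0.
have : nbhs x (ball x e) by exact: nbhsx_ballx.
exact: filterS.
Qed.

(** The midpoint of the images under [contract] lies strictly inside (-1, 1), so [expand] sends it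
    to a finite value. *)
Lemma ereal_lt_between (R : realType) (x y : \bar R) :
  (x < y)%E -> exists r : R, (x < r%:E < y)%E.
Proof.
rewrite -lt_contract => xy.
pose m := (contract x + contract y) / 2.
have xm : contract x < m by rewrite (midf_lt xy).
have my : m < contract y by rewrite (midf_lt xy).
have m1 : `|m| < 1.
  rewrite ltr_norml (le_lt_trans _ xm) ?(lt_le_trans my) //.
    by have := contract_le1 y; rewrite ler_norml => /andP[].
  by have := contract_le1 x; rewrite ler_norml => /andP[].
exists (fine (expand m)); rewrite fine_expand // -!lt_contract.
by rewrite expandK ?xm // inE ltW.
Qed.

(** Balls of the extended reals are measured through [contract], which cancels [expand] on
    [-1, 1]. *)
Lemma continuous_expand_comp (R : realType) (K : topologicalType) (h : K -> R) :
  (forall k, `|h k| <= 1) -> continuous h -> continuous (fun k => expand (h k)).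
Proof.
move=> h1 ch k; apply/cvg_ballP => e e0.
have /cvgrPdist_lt/(_ _ e0) := ch k.
apply: filterS => k' hk'.
by rewrite /ball/= /ereal_ball !expandK ?inE ?h1.
Qed.

(** Regularity of compact Hausdorff spaces gives a neighbourhood whose closure lies in [U]; the
    closure of its interior is open by extremal disconnectedness. *)
Lemma clopen_ext_disconnected_nbhs (K : topologicalType)
    (hKcompact : compact [set: K]) (hKhausdorff : hausdorff_space K)
    (hKed : extremally_disconnected K) (U : set K) (k : K) :
  open U -> U k -> exists V, [/\ clopen V, V k & V `<=` U].
Proof.
move=> oU Uk.
have [W kW WU] : exists2 W, nbhs k W & closure W `<=` U.
  apply: (compact_regular hKhausdorff hKcompact filterT).
  exact: open_nbhs_nbhs.
exists (closure W^°); split.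
- split; last exact: closed_closure.
  exact: (hKed _ (@open_interior _ W)).
- exact: subset_closure.
- exact: subset_trans (closure_subset (@interior_subset _ W)) WU.
Qed.

(** * Gluing, finiteness and distributivity for extended real functions *)

Section ContExt.
Context {R : realType} {K : topologicalType}.
Implicit Types f g h w : contExt K R.

Lemma ctse_leP f g : reflect (forall k, (f k <= g k)%E) (f <= g)%O.
Proof. exact: asboolP. Qed.

Fact ctse_glue_cts (V : set K) f g : clopen V ->
  continuous (fun k => if k \in V then f k else g k).
Proof.
move=> [oV cV] k; have [kV|kV] := boolP (k \in V).
- have : {near k, f =1 (fun k => if k \in V then f k else g k)}.
    near=> k'; rewrite ifT //; apply: mem_set; near: k'.
    by apply: open_nbhs_nbhs; split => //; exact: set_mem.
  by move=> /near_eq_cvg/cvg_trans; apply; rewrite kV; exact: cts_fun.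
- have : {near k, g =1 (fun k => if k \in V then f k else g k)}.
    near=> k'; rewrite ifF //; apply: memNset; near: k'.
    apply: open_nbhs_nbhs; split; last by move: kV; rewrite notin_setE.
    exact: closed_openC.
  by move=> /near_eq_cvg/cvg_trans; apply; rewrite (negbTE kV); exact: cts_fun.
Unshelve. all: by end_near. Qed.

Definition ctse_glue (V : set K) (cV : clopen V) f g : contExt K R :=
  mkcts (@ctse_glue_cts V f g cV).

Lemma open_finite_locus f : open (finite_locus f).
Proof.
have -> : finite_locus f =
    (f @^-1` [set y | (-oo < y)%E]) `&` (f @^-1` [set y | (y < +oo)%E]).
  by apply/seteqP; split => k; rewrite /finite_locus /= fin_numElt => /andP.
by apply: openI; apply: open_comp => [k _|];
  [exact: cts_fun|exact: open_ereal_gt_ereal|exact: cts_fun|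
   exact: open_ereal_lt_ereal].
Qed.

Lemma Cinfty_fin f : (forall k, f k \is a fin_num) -> @Cinfty R K f.
Proof.
move=> ff; split; first exact: open_finite_locus.
by move=> O [k Ok] _; exists k; split => //; exact: ff.
Qed.

(** [g] is finite wherever [f] and [h] both are, and two open dense sets meet in a dense set. *)
Lemma Cinfty_between f g h :
  (f <= g)%O -> (g <= h)%O -> @Cinfty R K f -> @Cinfty R K h -> @Cinfty R K g.
Proof.
move=> /ctse_leP fg /ctse_leP gh [oF dF] [oH dH].
split; first exact: open_finite_locus.
have dFH := denseI oF dF dH.
move=> O O0 oO; have [k [Ok [fk hk]]] := dFH O O0 oO.
exists k; split => //; move: fk hk (fg k) (gh k); rewrite /finite_locus /=.
by case: (f k) (h k) (g k) => [r||] [s||] [t||].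
Qed.

(** The infinite distributive law. If it failed at [k], then [w < f] on a clopen [V] around [k], so
    every member of [A] is at most [w] there. Replacing [g] by [w] on [V] would give an upper bound
    of [A] smaller than [g] at [k]. *)
Lemma ctse_meet_supremum
    (hKcompact : compact [set: K]) (hKhausdorff : hausdorff_space K)
    (hKed : extremally_disconnected K) (A : set (contExt K R)) f g w :
  supremums A g -> (forall a, A a -> (Order.meet a f <= w)%O) ->
  (Order.meet g f <= w)%O.
Proof.
move=> [ubg lubg] Aw; apply/ctse_leP => k; rewrite leNgt; apply/negP.
rewrite lt_min => /andP[wg wf].
have [U [oU Uk wUf]] : exists U, [/\ open U, U k & forall k', U k' -> (w k' < f k')%E].
  have [m /andP[wm mf]] : exists m, (w k < m < f k)%E.
    by have [m] := ereal_lt_between wf; exists m%:E.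
  exists ((w @^-1` [set y | (y < m)%E]) `&` (f @^-1` [set y | (m < y)%E])).
  split => //; last by move=> k' [/= a b]; exact: lt_trans b.
  by apply: openI; apply: open_comp => [? _|];
    [exact: cts_fun|exact: open_ereal_lt_ereal|exact: cts_fun|
     exact: open_ereal_gt_ereal].
have [V [cV Vk VU]] :=
  clopen_ext_disconnected_nbhs hKcompact hKhausdorff hKed oU Uk.
have /ctse_leP/(_ k) : (g <= ctse_glue cV w g)%O.
  apply: lubg => a Aa; apply/ctse_leP => k'.
  rewrite /ctse_glue /= /mkcts; case: ifPn => [/set_mem/VU/wUf wfk'|_].
    have /ctse_leP/(_ k') := Aw a Aa.
    by rewrite /Order.meet/= /mkcts ge_min [(f k' <= _)%E]leNgt wfk' orbF.
  by have /ctse_leP := ubg a Aa; exact.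
by rewrite /ctse_glue /= /mkcts mem_set// leNgt wg.
Qed.

End ContExt.

(** * Order completions of an up-set and transfer between them *)

Section ConeCompletion.
Context {dE : Order.disp_t} {E : latticeType dE}.
Variable z : E.

(* By the last field, [i e <= sup (i @` B)] is decided inside [E]; this is what
   makes the up-sets of [i z] in any two such [L] isomorphic. *)
Record is_cone_completion (d : Order.disp_t) (L : latticeType d) (i : E -> L) : Prop := {
  ccompl_supremum : forall A : set L, A !=set0 -> supremums A !=set0 ;
  ccompl_dense : forall y : L, (i z <= y)%O ->
    supremums (i @` [set e | (z <= e)%O /\ (i e <= y)%O]) y ;
  ccompl_le_supremum : forall (B : set E) (s : L) (e : E),
    B !=set0 -> supremums (i @` B) s ->
    ((i e <= s)%O <-> supremums [set Order.meet b e | b in B] e)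
}.

Lemma ccompl_leP (d : Order.disp_t) (L : latticeType d) (i : E -> L) :
  is_cone_completion i -> forall x y : L, (i z <= x)%O ->
  reflect (forall e, (z <= e)%O -> (i e <= x)%O -> (i e <= y)%O) (x <= y)%O.
Proof.
move=> hi x y zx; apply: (iffP idP) => [xy e _ ex|h]; first exact: le_trans xy.
have [_] := ccompl_dense hi zx; apply => _ [e [ze ex] <-].
exact: h.
Qed.

(** The supremum criterion applied to the singleton of [y] gives the order embedding. *)
Lemma ccompl_le (d : Order.disp_t) (L : latticeType d) (i : E -> L) :
  is_cone_completion i -> forall x y : E, (i x <= i y)%O = (x <= y)%O.
Proof.
move=> hi x y; rewrite [RHS]leEmeet.
have yP : supremums (i @` [set y]) (i y) by rewrite image_set1 supremums1.
have [h1 h2] := ccompl_le_supremum hi x (ex_intro _ y erefl) yP.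
rewrite image_set1 supremums1 in h1 h2.
by apply/idP/eqP => [/h1 /= e|e]; [rewrite meetC -e|apply: h2; rewrite /= meetC].
Qed.

(** [T y] is the supremum in [L2] of the elements of [E] between [z] and [y]. Whether [e] lies below
    [y] or below [T y] is decided by the same condition inside [E]. *)
Lemma ccompl_transfer (d1 d2 : Order.disp_t) (L1 : latticeType d1)
    (L2 : latticeType d2) (i1 : E -> L1) (i2 : E -> L2) :
  is_cone_completion i1 -> is_cone_completion i2 ->
  exists T : L1 -> L2, forall y, (i1 z <= y)%O ->
    (i2 z <= T y)%O /\ forall e, (z <= e)%O -> (i2 e <= T y)%O = (i1 e <= y)%O.
Proof.
move=> h1 h2.
suff /choice[T hT] : forall y, exists y2, (i1 z <= y)%O ->
    (i2 z <= y2)%O /\ forall e, (z <= e)%O -> (i2 e <= y2)%O = (i1 e <= y)%O.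
  by exists T.
move=> y.
(* Outside the up-set of [i1 z] the value is an arbitrary default. *)
have [zy|] := boolP (i1 z <= y)%O; last by exists (i2 z).
pose B := [set e | (z <= e)%O /\ (i1 e <= y)%O].
have B0 : B !=set0 by exists z; split.
have [s sP] : supremums (i2 @` B) !=set0.
  apply: (ccompl_supremum h2); case: B0 => b Bb.
  by exists (i2 b); exists b.
exists s => _; split; first by apply: sP.1; exists z => //; split.
move=> e ze; apply/idP/idP => h.
- apply/(ccompl_le_supremum h1 e B0 (ccompl_dense h1 zy)).
  exact/(ccompl_le_supremum h2 e B0 sP).
- apply/(ccompl_le_supremum h2 e B0 sP).
  exact/(ccompl_le_supremum h1 e B0 (ccompl_dense h1 zy)).
Qed.

End ConeCompletion.

(** * The positive cone of the sup-completion *)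

Section SupCompletionCone.
Context {R : realType} {E : vectorLatticeType R} (C : supCompletion E).

Lemma scin_cone_completion : is_cone_completion (0 : E) (scin C).
Proof.
have sups (A : set C) : A !=set0 -> supremums A !=set0.
  move=> A0; apply: scompl_sup; split => //.
  by have [t tP] := scompl_top C; exists t => x _; exact: tP.
split => //.
- move=> y y0; split; first by move=> _ [e [_ ey] <-].
  move=> u ubu; have [_] := scompl_dense y; apply => _ [e /= ey <-].
  (* Passing from [e] to its positive part stays below [y], because [y] is positive. *)
  apply: (@le_trans _ _ (scin C (Order.join e 0))).
    by rewrite scin_le leUl.
  by apply: ubu; exists (Order.join e 0) => //; split; rewrite ?leUr// scin_join leUx ey.
- move=> B s e [b0 Bb0] [ubs lubs]; split => [es|[_ lube]].
  + split; first by move=> _ [b _ <-]; exact: leIr.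
    have [u uP] : supremums [set Order.meet b (scin C e) | b in scin C @` B] !=set0.
      apply: sups; exists (Order.meet (scin C b0) (scin C e)).
      by exists (scin C b0) => //; exists b0.
    (* [[set s]] and the image of [B] share the supremum [s]; cut by [e] they still share one, and
       for [[set s]] it is [e]. *)
    have eu : scin C e = u.
      apply: (@scompl_supI _ _ C [set s] (scin C @` B) s _ _ _ _ e) uP => //.
      * by exists s.
      * by exists (scin C b0); exists b0.
      * by rewrite supremums1.
      * by rewrite image_set1 (meet_r es) supremums1.
    move=> v ubv; rewrite -(scin_le C) eu; apply: uP.2 => _ [_ [b Bb <-] <-].
    by rewrite -scin_meet scin_le; apply: ubv; exists b.
  (* Solidity places the meet of [e] and [s] in [E], where it bounds all meets of [b] and [e], hence
     also [e]. *)
  + have [e0 _ e0E] := scompl_solid (leIr (scin C e) s).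
    apply: (@le_trans _ _ (Order.meet s (scin C e))); last exact: leIl.
    rewrite -e0E scin_le; apply: lube => _ [b Bb <-].
    rewrite -(scin_le C) e0E scin_meet leI2 // ubs //; by exists b.
Qed.

End SupCompletionCone.

(** * Vector lattices represented by densely finite functions *)

Lemma vlat_subr_ge0 (R : numDomainType) (V : vectorLatticeType R) (x y : V) :
  (0 <= y - x) = (x <= y).
Proof.
apply/idP/idP => [h|h].
- by have := vlat_leD2r x _ _ h; rewrite add0r subrK.
- by have := vlat_leD2r (- x) _ _ h; rewrite subrr.
Qed.

Section CinftyIso.
Context {R : realType} {K : topologicalType} {V : vectorLatticeType R}.
Variables (Phi : V -> contExt K R) (hPhi : is_Cinfty_iso Phi).

Lemma Cinfty_iso_inj : injective Phi.
Proof. by have [_ + _] := cinf_bij hPhi => inj x y; apply: inj; rewrite inE. Qed.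

Lemma Cinfty_iso_le (x y : V) : (Phi x <= Phi y)%O = (x <= y).
Proof. by rewrite !leEjoin -cinf_join // (inj_eq Cinfty_iso_inj). Qed.

Lemma Cinfty_iso_surj f : Cinfty f -> exists x, Phi x = f.
Proof. by have [_ _ +] := cinf_bij hPhi => /[apply] -[x _ <-]; exists x. Qed.

Lemma Cinfty_isoP x : Cinfty (Phi x).
Proof. by have [+ _ _] := cinf_bij hPhi; apply. Qed.

Lemma Cinfty_iso0 k : Phi 0 k = 0%E.
Proof. by rewrite -(scale0r 0) cinf_scale //= /mkcts mul0e. Qed.

(* [contract] maps [\bar R] homeomorphically onto [-1, 1], so that suprema in
   [C(K, \bar R)] are suprema of families bounded by [1] in [Cinfty]. *)
Lemma ctse_supremums_neq0 (hV : dedekind_complete V) (A : set (contExt K R)) :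
  supremums A !=set0.
Proof.
have Ects (h : K -> R) : continuous h -> continuous (EFin \o h).
  move=> ch k; apply: cvg_EFin; first exact: nearW.
  exact: ch.
have ccts (f : contExt K R) : continuous (fun k => (contract (f k))%:E).
  apply: Ects => k; apply: continuous_comp; first exact: cts_fun.
  exact: continuous_contract.
pose c f : contExt K R := mkcts (ccts f).
have cC f : Cinfty (c f) by exact: Cinfty_fin.
have c1 f k : (-1 <= c f k <= 1)%E.
  by rewrite /c/= /mkcts !lee_fin -ler_norml contract_le1.
have [one Pone] : exists x, Phi x = cst 1%E.
  by apply: Cinfty_iso_surj; exact: Cinfty_fin.
have [mone Pmone] : exists x, Phi x = cst (-1)%E.
  by apply: Cinfty_iso_surj; exact: Cinfty_fin.
(* Including [mone] keeps [B] nonempty when [A] is empty and bounds its supremum below by -1. *)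
pose B := [set x | x = mone \/ exists2 f, A f & Phi x = c f].
have Bone : ubound B one.
  move=> x [->|[f Af xf]]; rewrite -Cinfty_iso_le Pone.
    by rewrite Pmone; apply/ctse_leP => k /=; rewrite lee_fin (le_trans (lerN10 _)).
  by rewrite xf; apply/ctse_leP => k; have /andP[] := c1 f k.
have [s [ubs lubs]] : supremums B !=set0.
  by apply: hV; split; [exists mone; left|exists one].
have s1 k : (-1 <= Phi s k <= 1)%E.
  apply/andP; split.
    have : (mone <= s)%O by apply: ubs; left.
    by rewrite -Cinfty_iso_le Pmone => /ctse_leP/(_ k).
  have : (s <= one)%O by exact: lubs.
  by rewrite -Cinfty_iso_le Pone => /ctse_leP/(_ k).
have sfin k : Phi s k \is a fin_num.
  by have := s1 k; case: (Phi s k) => [r||] /andP[].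
pose h k := fine (Phi s k).
have h1 k : `|h k| <= 1.
  by have := s1 k; rewrite -(fineK (sfin k)) !lee_fin ler_norml.
have hcts : continuous h.
  move=> k; apply: fine_cvg; rewrite fineK //.
  exact: cts_fun.
exists (mkcts (continuous_expand_comp h1 hcts) : contExt K R); split.
- move=> f Af; apply/ctse_leP => k /=; rewrite /mkcts.
  rewrite -le_contract expandK ?inE // -lee_fin fineK //.
  have [x xf] := Cinfty_iso_surj (cC f).
  have : (x <= s)%O by apply: ubs; right; exists f.
  by rewrite -Cinfty_iso_le xf => /ctse_leP/(_ k).
- move=> g ubg; apply/ctse_leP => k /=; rewrite /mkcts.
  rewrite -le_contract expandK ?inE // -lee_fin fineK //.
  have [x xg] := Cinfty_iso_surj (cC g).
  have : (s <= x)%O.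
    apply: lubs => y [->|[f Af yf]]; rewrite -Cinfty_iso_le xg.
      by rewrite Pmone; apply/ctse_leP => k'; have /andP[] := c1 g k'.
    rewrite yf; apply/ctse_leP => k'.
    by rewrite /c/= /mkcts lee_fin le_contract; apply/ctse_leP/ubg.
  by rewrite -Cinfty_iso_le xg => /ctse_leP/(_ k).
Qed.

End CinftyIso.

(** * Functions on K as a completion of E *)

Section UniversalCompletion.
Context {R : realType} {K : topologicalType} {E Eu : vectorLatticeType R}.
Variables (j : {linear E -> Eu}) (hEu : is_universal_completion j).
Variables (Phi : Eu -> contExt K R) (hPhi : is_Cinfty_iso Phi).

Let psi (e : E) : contExt K R := Phi (j e).

Lemma ucompl_le (x y : E) : (j x <= j y) = (x <= y).
Proof. by rewrite !leEjoin -ucompl_join // (inj_eq (ucompl_inj hEu)). Qed.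

Lemma ucompl_rep_le (x y : E) : (psi x <= psi y)%O = (x <= y).
Proof. by rewrite (Cinfty_iso_le hPhi) ucompl_le. Qed.

(** Order density makes the embedding preserve suprema: a gap between [psi e] and an upper bound cut
    by [psi e] would contain a positive element of [E], which could be subtracted from [e]. *)
Lemma ucompl_rep_supremum (B : set E) e :
  B !=set0 -> supremums B e -> supremums (psi @` B) (psi e).
Proof.
move=> [b0 Bb0] [ube lube]; split.
  by move=> _ [b Bb <-]; rewrite ucompl_rep_le; exact: ube.
move=> w ubw.
have [y yw] : exists y, Phi y = Order.meet w (psi e).
  apply: (Cinfty_iso_surj hPhi).
  (* An upper bound [w] need not be densely finite, but its meet with [psi e] lies between [psi b0]
     and [psi e]. *)
  apply: (@Cinfty_between _ _ (psi b0) _ (psi e)); try exact: (Cinfty_isoP hPhi).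
    by rewrite lexI ubw ?ucompl_rep_le ?ube //; exists b0.
  exact: leIr.
have yje : (y <= j e)%O by rewrite -(Cinfty_iso_le hPhi) yw leIr.
have jby b : B b -> (j b <= y)%O.
  move=> Bb; rewrite -(Cinfty_iso_le hPhi) yw lexI ubw ?ucompl_rep_le ?ube //.
  by exists b.
have [yE|yne] := eqVneq y (j e); first by rewrite /psi -yE yw leIl.
have : 0 < j e - y by rewrite lt_def subr_eq0 eq_sym yne vlat_subr_ge0.
move=> /(ucompl_dense hEu)[x /andP[x0 xle]].
(* Each [j b] is at most [y], and [y] is at most [j e - j x], so [e - x] bounds [B]. Leastness of
   [e] then contradicts [0 < j x]. *)
have : (e <= e - x)%O.
  apply: lube => b Bb; rewrite -ucompl_le raddfB.
  apply: (le_trans (jby _ Bb)); rewrite -vlat_subr_ge0.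
  by rewrite addrAC vlat_subr_ge0.
rewrite -vlat_subr_ge0 addrAC subrr add0r -ucompl_le raddf0 raddfN.
rewrite -[- _]sub0r vlat_subr_ge0 => /le_lt_trans/(_ x0).
by rewrite ltxx.
Qed.

(** An Archimedean argument. If an upper bound [g] does not dominate [f], then [g < a < b < f] on
    some clopen [V]. A nonzero positive [e] under the step of height [b - a] on [V] has all its
    multiples below [f], hence below [g], which is impossible where [psi e] is positive. *)
Lemma ucompl_rep_dense
    (hKcompact : compact [set: K]) (hKhausdorff : hausdorff_space K)
    (hKed : extremally_disconnected K) f :
  (psi 0 <= f)%O -> supremums (psi @` [set e | 0 <= e /\ (psi e <= f)%O]) f.
Proof.
move=> f0; split; first by move=> _ [e [_ ef] <-].
move=> g ubg; apply/ctse_leP => k; rewrite leNgt; apply/negP.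
move=> /ereal_lt_between[b /andP[gb bf]].
have [a /andP[ga ab]] := ereal_lt_between gb.
have psi0 k' : psi 0 k' = 0%E by rewrite /psi raddf0 Cinfty_iso0.
have [V [cV Vk VU]] : exists V, [/\ clopen V, V k &
    V `<=` (g @^-1` [set y | (y < a%:E)%E]) `&` (f @^-1` [set y | (b%:E < y)%E])].
  apply: clopen_ext_disconnected_nbhs => //.
  by apply: openI; apply: open_comp => [? _|];
    [exact: cts_fun|exact: open_ereal_lt_ereal|exact: cts_fun|
     exact: open_ereal_gt_ereal].
pose h : contExt K R := ctse_glue cV (cst (b - a)%:E) (cst 0%E).
have hV k' : V k' -> h k' = (b - a)%:E.
  by move=> Vk'; rewrite /h/= /mkcts mem_set.
have hNV k' : ~ V k' -> h k' = 0%E.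
  by move=> Vk'; rewrite /h/= /mkcts memNset.
have [x xh] : exists x, Phi x = h.
  apply: (Cinfty_iso_surj hPhi); apply: Cinfty_fin => k'.
  by have [/hV->|/hNV->] := pselect (V k').
have ba0 : 0 < b - a by rewrite subr_gt0 -lte_fin.
have x0 : 0 < x.
  rewrite lt_def; apply/andP; split; last first.
    rewrite -(Cinfty_iso_le hPhi) xh; apply/ctse_leP => k'.
    rewrite Cinfty_iso0 //; have [/hV->|/hNV->//] := pselect (V k').
    by rewrite lee_fin ltW.
  apply/eqP => x0; have := hV _ Vk; rewrite -xh x0 Cinfty_iso0 // => -[] /eqP.
  by rewrite lt_eqF.
have [e /andP[e0 ex]] := ucompl_dense hEu x0.
have eh k' : (psi e k' <= h k')%E.
  by rewrite -xh; move: k'; apply/ctse_leP; rewrite (Cinfty_iso_le hPhi).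
have e0' : 0 <= e by rewrite -ucompl_le raddf0 ltW.
have epos k' : (0 <= psi e k')%E.
  by rewrite -(psi0 k'); move: k'; apply/ctse_leP; rewrite ucompl_rep_le.
have hfin k' : h k' \is a fin_num.
  by have [/hV->|/hNV->] := pselect (V k').
have efin k' : psi e k' \is a fin_num.
  by rewrite ge0_fin_numE // (le_lt_trans (eh k')) // ltey_eq hfin.
have scl n k' : psi (n%:R *: e) k' = (n%:R%:E * psi e k')%E.
  by rewrite /psi linearZ /= cinf_scale.
(* On [V] the multiple by [n] is at most [g < a], so one more [e] reaches at most
   [a + (b - a) = b < f]. Off [V], [psi e] vanishes. *)
have neS n : [set e | 0 <= e /\ (psi e <= f)%O] (n%:R *: e).
  elim: n => [|n IH]; first by rewrite /= scale0r.
  have [n0 /ctse_leP nf] := IH.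
  have nS : n.+1%:R *: e = n%:R *: e + e by rewrite -natr1 scalerDl scale1r.
  split; first by rewrite -(scaler0 _ n.+1%:R) vlat_leZ.
  apply/ctse_leP => k'; rewrite nS /psi raddfD.
  have nfin : Phi (j (n%:R *: e)) k' \is a fin_num.
    by rewrite -/(psi _) scl fin_numM.
  rewrite cinf_add //.
  have [Vk'|/hNV hk'] := pselect (V k'); last first.
    have -> : Phi (j e) k' = 0%E by apply/eqP; rewrite eq_le epos -hk' eh.
    by rewrite adde0; exact: nf.
  have [ga' bf'] := VU _ Vk'.
  apply: ltW; apply: le_lt_trans bf'.
  rewrite -[b](subrKC a) EFinD leeD //; last by rewrite -(hV k') //; exact: eh.
  apply: le_trans (ltW ga').
  have /ctse_leP : (psi (n%:R *: e) <= g)%O by apply: ubg; exists (n%:R *: e).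
  exact.
have [k' ek'] : exists k', (0 < psi e k')%E.
  apply/not_existsP => H; move: e0; rewrite lt_def -(Cinfty_iso_le hPhi).
  move=> /andP[/eqP + _]; apply; apply: (Cinfty_iso_inj hPhi).
  apply/continuousEP => k'; rewrite Cinfty_iso0 //.
  by apply/eqP; rewrite eq_le epos andbT leNgt; apply/negP/H.
have Vk' : V k'.
  apply: contrapT => /hNV hk'; have := eh k'; rewrite hk' leNgt.
  by rewrite ek'.
have [ga' _] := VU _ Vk'.
pose r := fine (psi e k').
have r0 : 0 < r by rewrite fine_gt0 // ek' ltey_eq efin.
(* With [n > a / r], the multiple by [n] exceeds [a], hence [g], at [k']. *)
pose n := Num.bound `|a / r|.
have /ctse_leP/(_ k') : (psi (n%:R *: e) <= g)%O.
  by apply: ubg; exists (n%:R *: e).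
rewrite scl -(fineK (efin k')) -/r -EFinM => /le_lt_trans/(_ ga').
rewrite lte_fin -ltr_pdivlMr // ltNge ltW //.
exact: le_lt_trans (ler_norm _) (archi_boundP (normr_ge0 _)).
Qed.

(** In the supremum criterion, one direction is the infinite distributive law and the other is
    preservation of suprema of [E]. *)
Lemma ucompl_rep_cone_completion
    (hKcompact : compact [set: K]) (hKhausdorff : hausdorff_space K)
    (hKed : extremally_disconnected K) :
  is_cone_completion (0 : E) (fun e => Phi (j e)).
Proof.
split.
- by move=> A _; exact: ctse_supremums_neq0 hPhi (ucompl_dedekind hEu) A.
- by move=> y y0; exact: ucompl_rep_dense.
- move=> B s e [b0 Bb0] sP.
  have meetE b : Phi (j (Order.meet b e)) = Order.meet (Phi (j b)) (Phi (j e)).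
    by rewrite (ucompl_meet hEu) cinf_meet.
  split => [es|eP].
  + split; first by move=> _ [b _ <-]; exact: leIr.
    move=> u ubu; rewrite -ucompl_rep_le -[leLHS](meet_r es).
    apply: (ctse_meet_supremum hKcompact hKhausdorff hKed sP).
    move=> _ [b Bb <-]; rewrite -meetE ucompl_rep_le.
    by apply: ubu; exists b.
  + have := ucompl_rep_supremum (ex_intro _ _ (ex_intro2 _ _ b0 Bb0 erefl)) eP.
    move=> [_]; apply => _ [_ [b Bb <-] <-]; rewrite [psi _]meetE.
    by apply: le_trans (leIl _ _) _; apply: sP.1; exists b.
Qed.

End UniversalCompletion.

(** * Lattice stars, positive and negative parts, scaling *)

(** Joins are determined by the order, so none has to be computed for pairs. *)
Lemma surj_embedding_lattice_star_iso (R : numDomainType) (dS dT : Order.disp_t)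
    (S : latticeStarType R dS) (T : latticeStarType R dT) (phi : S -> T) :
  (forall t, exists s, phi s = t) ->
  (forall p q, (phi p <= phi q)%O = (p <= q)%O) ->
  (forall (a : R) p, phi (starZ a p) = starZ a (phi p)) ->
  is_lattice_star_iso phi.
Proof.
move=> surj phi_le phiZ.
have phi_inj p q : phi p = phi q -> p = q.
  by move=> pq; apply: le_anti; rewrite -!phi_le pq lexx.
have [psi psiK] := choice surj.
split => // [|p q].
  by exists psi => // p; apply: phi_inj.
have [r rE] := surj (Order.join (phi p) (phi q)).
apply: le_anti; rewrite leUx !phi_le leUl leUr andbT -rE phi_le leUx.
by rewrite -!phi_le rE leUl leUr.
Qed.

(** One of [x] and [y] is zero, so the difference is defined and equals [x] or [- y]. *)
Lemma disjoint_sube_parts (R : realDomainType) (x y : \bar R) :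
  (0 <= x)%E -> (0 <= y)%E -> mine x y = 0%E ->
  [/\ (x +? - y)%E, maxe (x - y) 0 = x & maxe ((-1)%:E * (x - y)) 0 = y]%E.
Proof.
rewrite EFinN mulN1e => x0 y0; have [xy x0'|yx y0'] := leP x y.
- rewrite x0' fin_num_adde_defr // sub0e oppeK; split => //.
    by apply/max_idPr; rewrite leeNl oppe0.
  exact/max_idPl.
- rewrite y0' fin_num_adde_defl ?oppe0 // adde0; split => //.
    exact/max_idPl.
  by apply/max_idPr; rewrite leeNl oppe0.
Qed.

(** One term vanishes, so distributivity holds for [a] of either sign, even infinite. *)
Lemma disjoint_sube_muler (R : realDomainType) (a x y : \bar R) :
  mine x y = 0%E -> (a * (x - y) = a * x - a * y)%E.
Proof.
have [_ ->|_ ->] := leP x y; first by rewrite mule0 !sub0e muleN.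
by rewrite mule0 oppe0 !adde0.
Qed.

Lemma ereal_parts (R : realDomainType) (x : \bar R) :
  (maxe x 0 - maxe ((-1)%:E * x) 0 = x)%E /\
  (mine (maxe x 0) (maxe ((-1)%:E * x) 0) = 0)%E.
Proof.
rewrite EFinN mulN1e; have [x0|x0] := leP x 0%E.
- have nx0 : (0 <= - x)%E by rewrite oppe_ge0.
  by rewrite (max_idPl nx0) sub0e oppeK; split => //; apply/min_idPl.
- have nx0 : (- x <= 0)%E by rewrite oppe_le0 ltW.
  by rewrite (max_idPr nx0) sube0; split => //; apply/min_idPr/ltW.
Qed.

Lemma lstar_ler_pZ (R : numFieldType) (d : Order.disp_t)
    (S : latticeStarType R d) (a : R) (x y : S) :
  0 < a -> (starZ a x <= starZ a y)%O = (x <= y)%O.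
Proof.
move=> a0; apply/idP/idP; last by apply: lstar_leZ; exact: ltW.
have ai0 : 0 <= a^-1 by rewrite invr_ge0 ltW.
by move/(lstar_leZ _ _ _ ai0); rewrite !starZA mulVf ?gt_eqF // !star1Z.
Qed.

Lemma lcone_ler_pZ (R : numFieldType) (C : latticeConeType R)
    (a : nnscalar R) (x y : C) :
  0 < nnval a -> (a *: x <= a *: y) = (x <= y).
Proof.
move=> a0; apply/idP/idP; last exact: lcone_leZ.
have ai0 : 0 <= (nnval a)^-1 by rewrite invr_ge0 ltW.
have aK : NNScalar ai0 * a = 1 by apply: val_inj; rewrite /= mulVf ?gt_eqF.
by move/(lcone_leZ (NNScalar ai0)); rewrite !scalerA aK !scale1r.
Qed.

(** * The isomorphism of lattice stars *)

Section SupInfRepresentation.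
Context {R : realType} {K : topologicalType} {E : vectorLatticeType R}.
Variables (C : supCompletion E) (psi : E -> contExt K R).
Hypotheses (psi0 : psi 0 = cst 0%E)
  (psiZ : forall (a : R) e, psi (a *: e) = starZ a (psi e))
  (hpsi : is_cone_completion (0 : E) psi).

Local Notation zero := (cst 0%E : contExt K R).

Lemma sup_inf_completion_iso :
  exists phi : supInfCompletion C -> contExt K R, is_lattice_star_iso phi.
Proof.
have hC := scin_cone_completion C.
have [T T0 psiT] : exists2 T : C -> contExt K R,
    forall x, (0 : C) <= x -> (zero <= T x)%O &
    forall x e, (0 : C) <= x -> 0 <= e -> (psi e <= T x)%O = (scin C e <= x).
  have [T] := ccompl_transfer hC hpsi; rewrite scin0 psi0 => hT.
  by exists T => [x /hT[]//|x e /hT[_]]; apply.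
(* The transfer in the opposite direction, used to show that [T] reaches every positive function. *)
have [S S0 scS] : exists2 S : contExt K R -> C,
    forall f, (zero <= f)%O -> (0 : C) <= S f &
    forall f e, (zero <= f)%O -> 0 <= e -> (scin C e <= S f) = (psi e <= f)%O.
  have [S] := ccompl_transfer hpsi hC; rewrite scin0 psi0 => hS.
  by exists S => [f /hS[]//|f e /hS[_]]; apply.
(* A positive function is determined by the elements of [E_+] below it; the identities for [T]
   reduce to this test. *)
have ext f g : (zero <= f)%O -> (zero <= g)%O ->
    (forall e, 0 <= e -> (psi e <= f)%O = (psi e <= g)%O) -> f = g.
  move=> f0 g0 fg; apply: le_anti; rewrite -psi0 in f0 g0.
  apply/andP; split; apply/(ccompl_leP hpsi) => // e e0; by rewrite fg.
have TS f : (zero <= f)%O -> T (S f) = f.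
  move=> f0; apply: ext => //; first exact/T0/S0.
  by move=> e e0; rewrite psiT ?S0 // scS.
have T_le (x y : C) : (0 : C) <= x -> (0 : C) <= y -> (T x <= T y)%O = (x <= y).
  move=> x0 y0; apply/(ccompl_leP hpsi)/idP => [|h|xy e e0].
  - by rewrite psi0 T0.
  - apply/(ccompl_leP hC); first by rewrite scin0.
    by move=> e e0; rewrite -!psiT //; exact: h.
  - by rewrite !psiT // => /le_trans; apply.
have T00 : T 0 = cst 0%E.
  apply: ext => // [|e e0]; first exact: T0.
  by rewrite psiT // -psi0 -(scin0 C) scin_le (ccompl_le hpsi).
have T_meet (x y : C) : (0 : C) <= x -> (0 : C) <= y -> T (Order.meet x y) = Order.meet (T x) (T y).
  move=> x0 y0; have xy0 : (0 : C) <= Order.meet x y by rewrite lexI x0.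
  apply: ext => [||e e0]; rewrite ?lexI ?T0 // !psiT //.
  by rewrite lexI.
have T_scale (a : nnscalar R) (x : C) : (0 : C) <= x -> T (a *: x) = starZ (nnval a) (T x).
  (* For [a] nonzero, testing [a *: x] against [e] amounts to testing [x] against the multiple of
     [e] by the inverse of [a]. *)
  move=> x0; have [a0|an0] := eqVneq (nnval a) 0.
    have -> : a = 0 by exact: val_inj.
    by rewrite scale0r T00 star0Z.
  have a0 : 0 < nnval a by rewrite lt_def an0 nnval_ge0.
  apply: ext => [||e e0].
  - exact/T0/lcone_scale_ge0.
  - apply/ctse_leP => k; rewrite /= /mkcts mule_ge0 ?lee_fin ?nnval_ge0 //.
    by have /ctse_leP := T0 _ x0; apply.
  - have e'0 : 0 <= (nnval a)^-1 *: e.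
      by rewrite -(scaler0 _ (nnval a)^-1) vlat_leZ // invr_ge0 ltW.
    rewrite psiT ?lcone_scale_ge0 // -[e](scalerKV an0) scinZ psiZ.
    by rewrite lcone_ler_pZ // lstar_ler_pZ // psiT.
have T_disj (p : supInfCompletion C) k : [/\ (0 <= T (sival p).1 k)%E,
    (0 <= T (sival p).2 k)%E & mine (T (sival p).1 k) (T (sival p).2 k) = 0%E].
  have /and3P[p1 p2 /eqP p12] := sivalP p; split.
  - by have /ctse_leP := T0 _ p1; apply.
  - by have /ctse_leP := T0 _ p2; apply.
  - have := T_meet _ _ p1 p2; rewrite p12 T00.
    by move=> /continuousEP/(_ k).
have phi_cts (p : supInfCompletion C) :
    continuous (fun k => T (sival p).1 k - T (sival p).2 k)%E.
  move=> k; have [a b ab] := T_disj p k.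
  have [d _ _] := disjoint_sube_parts a b ab.
  by apply: cvgeB => //; exact: cts_fun.
pose phi p : contExt K R := mkcts (phi_cts p).
have phiE p k : phi p k = (T (sival p).1 k - T (sival p).2 k)%E by [].
have phi_pos p : Order.join (phi p) zero = T (sival p).1.
  apply/continuousEP => k; have [a b ab] := T_disj p k.
  by have [] := disjoint_sube_parts a b ab.
have phi_neg p : Order.join (starZ (-1) (phi p)) zero = T (sival p).2.
  apply/continuousEP => k; have [a b ab] := T_disj p k.
  by have [] := disjoint_sube_parts a b ab.
exists phi; apply: surj_embedding_lattice_star_iso => [f|p q|a p].
(* The preimage of [f] is the pair of images under [S] of its positive and negative parts. *)
- pose f1 := Order.join f zero.
  pose f2 := Order.join (starZ (-1) f) zero.
  have f10 : (zero <= f1)%O by exact: leUr.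
  have f20 : (zero <= f2)%O by exact: leUr.
  have f12 k : (f1 k - f2 k)%E = f k /\ mine (f1 k) (f2 k) = 0%E.
    exact: ereal_parts.
  have dP : is_disjoint_pair (S f1, S f2).
    apply/and3P; split; [exact: S0|exact: S0|] => /=.
    have m0 : (0 : C) <= Order.meet (S f1) (S f2) by rewrite lexI !S0.
    apply/eqP; apply: le_anti; rewrite m0 andbT -T_le // T_meet ?S0 // !TS // T00.
    by apply/ctse_leP => k; have [_ h] := f12 k; rewrite /Order.meet/= /mkcts h.
  exists (SupInfCompletion dP); apply/continuousEP => k.
  by rewrite phiE /= !TS //; have [] := f12 k.
- have /and3P[p1 p2 _] := sivalP p; have /and3P[q1 q2 _] := sivalP q.
  rewrite si_leE -(T_le _ _ p1 q1) -(T_le _ _ q2 p2); apply/idP/andP => [pq|[/ctse_leP pq1 /ctse_leP pq2]].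
    (* The positive part is monotone and the negative part antitone, which recovers the order on
       pairs. *)
    rewrite -!phi_pos -!phi_neg; split; apply: leU2 => //.
    exact: lstar_leN.
  by apply/ctse_leP => k; rewrite !phiE leeB.
- have /and3P[p1 p2 _] := sivalP p; apply/continuousEP => k.
  have [_ _ pk] := T_disj p k.
  (* A negative scalar swaps the components of a pair, matching the sign change of the
     difference. *)
  have [a0|a0] := leP 0 a.
    have -> : a = nnval (NNScalar a0) by [].
    rewrite phiE [sival _](si_scaleE (NNScalar a0) p) /= !T_scale //=.
    by rewrite /mkcts disjoint_sube_muler.
  have b0 : 0 <= - a by rewrite oppr_ge0 ltW.
  have -> : a = - nnval (NNScalar b0) by rewrite /= opprK.
  rewrite phiE [sival _](si_scaleNE (NNScalar b0) p) /= !T_scale //=.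
  rewrite /mkcts disjoint_sube_muler // opprK EFinN !mulNe oppeK.
  by rewrite addeC.
Qed.

End SupInfRepresentation.

Theorem theorem4p4 (R : realType)
    (E : vectorLatticeType R) (hE : dedekind_complete E)
    (Eu : vectorLatticeType R) (j : {linear E -> Eu})
    (hEu : is_universal_completion j)
    (K : topologicalType)
    (hKcompact : compact [set: K]) (hKhausdorff : hausdorff_space K)
    (hKed : extremally_disconnected K)
    (hKrep : exists Phi : Eu -> contExt K R, is_Cinfty_iso Phi)
    (Es : supCompletion E) :
  exists phi : supInfCompletion Es -> contExt K R, is_lattice_star_iso phi.
Proof.
have [Phi hPhi] := hKrep.
have hpsi := ucompl_rep_cone_completion hEu hPhi hKcompact hKhausdorff hKed.
apply: (@sup_inf_completion_iso _ _ _ Es (fun e => Phi (j e))).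
- by apply/continuousEP => k; rewrite raddf0 (Cinfty_iso0 hPhi).
- by move=> a e; rewrite linearZ /= (cinf_scale hPhi).
- exact: hpsi.
Qed.
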